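(* Let $\mu\in\mathcal M(Z\times Z)$ have a diagonal concentration $\mu_\infty$. Then $\operatorname{supp}(\mu_\infty)\subseteq\operatorname{diag}(Z\times Z)$.
   Context: $N\ge1$ is an integer; $Z=\mathbb R^N\times\mathbb R^N=\mathbb R^{2N}$ is endowed with a scalar product, with corresponding norm $\|\cdot\|$; $\operatorname{diag}(Z\times Z)=\{(z,z):z\in Z\}$. For a metric space $X$, $\mathcal M(X)$ is the set of (positive) Radon measures on $X$, $\mathcal M_b(X)=\{\mu\in\mathcal M(X):\mu(X)<\infty\}$, and $C_b(X)$ is the set of bounded continuous real functions on $X$. For $\mu\in\mathcal M(Z\times Z)$ and $\beta>0$, the thermalized measure is $$\mu_\beta:=w_\beta\,\mu,\quad w_\beta(y,z):=B_\beta^{-1}e^{-\beta\|y-z\|^2},\quad B_\beta:=\int_Z e^{-\beta\|\xi\|^2}\,d\xi .$$ Definition (diagonal concentration). $\mu\in\mathcal M(Z\times Z)$ has a diagonal concentration if (i) there is $\beta_*\ge0$ such that $\mu_\beta\in\mathcal M_b(Z\times Z)$ for all $\beta>\beta_*$, and (ii) there is $\mu_\infty\in\mathcal M_b(Z\times Z)$ such that $\int f\,d\mu_\beta\to\int f\,d\mu_\infty$ as $\beta\to+\infty$ for all $f\in C_b(Z\times Z)$. The measure $\mu_\infty$ is then called the diagonal concentration of $\mu$. *)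

(* Defs.v *)
From HB Require Import structures.
From mathcomp Require Import all_boot all_order all_algebra.
From mathcomp Require Import sesquilinear.
From mathcomp Require Import all_classical all_reals all_analysis.
From mathcomp Require Import measurable_realfun.

Set Implicit Arguments.
Unset Strict Implicit.
Unset Printing Implicit Defensive.

Import Order.TTheory GRing.Theory Num.Theory.
Import numFieldNormedType.Exports.

Local Open Scope classical_set_scope.
Local Open Scope ring_scope.

(* A product of pointed topological spaces is one; the library only has the
   two structures separately. *)
HB.saturate prod.

Notation borel T := (g_sigma_algebraType (@open T)).

Section borel_measures.
Context {R : realType} {X : ptopologicalType}.
Implicit Types mu : {measure set (borel X) -> \bar R}.
Local Open Scope ereal_scope.

(* Locally finite, and inner regular with respect to compact sets. *)
Definition radon mu : Prop :=
  (forall x : X, exists2 U : set X, open_nbhs x U & mu U < +oo) /\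
  (forall A : set (borel X), measurable A ->
    mu A = ereal_sup [set mu K | K in [set K : set X | compact K /\ K `<=` A]]).

Definition finite_radon mu : Prop := radon mu /\ mu setT < +oo.

Definition supp mu : set X :=
  [set x | forall U : set X, open_nbhs x U -> 0 < mu U].

Definition bounded_continuous (f : X -> R) : Prop :=
  continuous f /\ (exists M : R, forall x, (`|f x| <= M)%R).

End borel_measures.

Lemma continuous_measurable_borel (R : realType) (X : ptopologicalType)
    (f : X -> R) :
  continuous f -> measurable_fun [set: borel X] (f : borel X -> R).
Proof.
move=> /continuousP cf.
apply: (measurability _ (RGenOpens.measurableE R)).
move=> _ [_ [a [b ->] <-]].
by rewrite setTI; apply: sub_sigma_algebra; apply: cf; exact: interval_open.
Qed.

(* Lebesgue measure on R^n: the n-fold product of the one-dimensional one, on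
   the product sigma-algebra of n.-tuple R. *)
Section lebesgue_tuple.
Context {R : realType}.
Local Notation RR := (measurableTypeR R).

Definition tcons n (p : RR * n.-tuple RR) : n.+1.-tuple RR :=
  [tuple of p.1 :: p.2].

Definition lebesgue_cons n (m : set (n.-tuple RR) -> \bar R) :
    set (n.+1.-tuple RR) -> \bar R :=
  pushforward (lebesgue_measure \x m)%E (@tcons n).

Fixpoint lebesgue_tuple n : set (n.-tuple RR) -> \bar R :=
  if n is n'.+1 then lebesgue_cons (@lebesgue_tuple n') else \d_([tuple]).
Arguments lebesgue_tuple n _ : clear implicits.

Lemma measurable_tcons n : measurable_fun setT (@tcons n).
Proof. exact: measurable_cons. Qed.

Section lebesgue_cons_measure.
Variables (n : nat) (m : {sigma_finite_measure set (n.-tuple RR) -> \bar R}).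

Let lm : {measure set (RR * n.-tuple RR)%type -> \bar R} :=
  (lebesgue_measure \x m)%E.

Let lebesgue_cons0 : lebesgue_cons m set0 = 0%E.
Proof. by rewrite /lebesgue_cons /pushforward preimage_set0 (measure0 lm). Qed.

Let lebesgue_cons_ge0 A : (0 <= lebesgue_cons m A)%E.
Proof. exact: (measure_ge0 lm). Qed.

Let lebesgue_cons_sigma_additive : semi_sigma_additive (lebesgue_cons m).
Proof.
exact: (@measure_semi_sigma_additive _ _ _
  (measure_function_pushforward__canonical__measure_function_Measure lm
     (@measurable_tcons n))).
Qed.

HB.instance Definition _ := isMeasure.Build _ _ _ (lebesgue_cons m)
  lebesgue_cons0 lebesgue_cons_ge0 lebesgue_cons_sigma_additive.

Let lebesgue_cons_sigma_finite : sigma_finite setT (lebesgue_cons m).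
Proof.
have /sigma_finiteP[F [FT ndF mF]] := sigma_finiteT (@lebesgue_measure R).
have /sigma_finiteP[G [GT ndG mG]] := sigma_finiteT m.
pose u (t : n.+1.-tuple RR) : RR * n.-tuple RR :=
  (thead t, [tuple of behead t]).
have cK q : u (tcons q) = q.
  by case: q => x y; rewrite /u /tcons /=; congr pair; exact/val_inj.
have mu_ : measurable_fun setT u.
  apply/measurable_fun_pair => /=; first exact: measurable_tnth.
  exact: measurable_behead.
exists (fun i => u @^-1` (F i `*` G i)).
  apply/esym; rewrite -subTset => t _.
  have [i _ Fi] : (\bigcup_i F i) (u t).1 by rewrite -FT.
  have [j _ Gj] : (\bigcup_i G i) (u t).2 by rewrite -GT.
  exists (maxn i j) => //; split.
    by move: Fi; exact/subsetPset/ndF/leq_maxl.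
  by move: Gj; exact/subsetPset/ndG/leq_maxr.
move=> i; have [mFi Foo] := mF i; have [mGi Goo] := mG i.
have mFG : measurable (F i `*` G i) by exact: measurableX.
split; first by rewrite -[X in measurable X]setTI; exact: mu_.
rewrite /lebesgue_cons /pushforward (_ : _ @^-1` _ = F i `*` G i); last first.
  by apply/funext => q; rewrite /preimage /mkset cK.
by rewrite product_measure1E// lte_mul_pinfty// ge0_fin_numE.
Qed.

HB.instance Definition _ := Measure_isSigmaFinite.Build _ _ _ (lebesgue_cons m)
  lebesgue_cons_sigma_finite.

End lebesgue_cons_measure.

Lemma lebesgue_tuple_measure n :
  exists m : {sigma_finite_measure set (n.-tuple RR) -> \bar R},
    lebesgue_tuple n = m.
Proof.
elim: n => [|n [m /= ->]]; first by exists (\d_([tuple] : 0.-tuple RR)).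
by exists (lebesgue_cons m).
Qed.

Section lebesgue_tuple_instance.
Variable n : nat.

Let lebesgue_tuple0 : lebesgue_tuple n set0 = 0%E.
Proof. by have [m ->] := lebesgue_tuple_measure n; exact: measure0. Qed.

Let lebesgue_tuple_ge0 A : (0 <= lebesgue_tuple n A)%E.
Proof. by have [m ->] := lebesgue_tuple_measure n; exact: measure_ge0. Qed.

Let lebesgue_tuple_sigma_additive : semi_sigma_additive (lebesgue_tuple n).
Proof.
by have [m ->] := lebesgue_tuple_measure n; exact: measure_semi_sigma_additive.
Qed.

HB.instance Definition _ := isMeasure.Build _ _ _ (lebesgue_tuple n)
  lebesgue_tuple0 lebesgue_tuple_ge0 lebesgue_tuple_sigma_additive.

Let lebesgue_tuple_sigma_finite : sigma_finite setT (lebesgue_tuple n).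
Proof. by have [m ->] := lebesgue_tuple_measure n; exact: sigma_finiteT. Qed.

HB.instance Definition _ := Measure_isSigmaFinite.Build _ _ _
  (lebesgue_tuple n) lebesgue_tuple_sigma_finite.

End lebesgue_tuple_instance.

End lebesgue_tuple.
Arguments lebesgue_tuple {R} n _.

Notation phase_space R N := ('rV[R]_N * 'rV[R]_N)%type.

Section phase_space.
Context {R : realType} {N : nat}.
Local Notation RR := (measurableTypeR R).
Local Notation Z := (phase_space R N).

Definition phase_of_tuple (t : (N + N).-tuple RR) : Z :=
  (\row_i tnth t (lshift N i), \row_i tnth t (rshift N i)).

Lemma measurable_phase_of_tuple :
  measurable_fun setT (phase_of_tuple : (N + N).-tuple RR -> borel Z).
Proof.
apply: measurability => // _ [U oU <-]; rewrite setTI.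
pose box (q : (N + N).-tuple rat) (k : nat) : set ((N + N).-tuple RR) :=
  [set t | forall i, `|ratr (tnth q i) - tnth t i| < k.+1%:R^-1].
have mbox q k : measurable (box q k).
  rewrite (_ : box q k = \bigcap_(i in [set: 'I_(N + N)])
      ((fun t => tnth t i) @^-1` (ball (ratr (tnth q i) : R) k.+1%:R^-1))).
    apply: fin_bigcap_measurable => // i _.
    rewrite -[X in measurable X]setTI; apply: measurable_tnth => //.
    exact: measurable_ball.
  by apply/seteqP; split=> [t h i _|t h i]; exact: h.
pose F (p : (N + N).-tuple rat * nat) : set ((N + N).-tuple RR) :=
  if `[< box p.1 p.2 `<=` phase_of_tuple @^-1` U >] then box p.1 p.2 else set0.
rewrite (_ : _ @^-1` _ = \bigcup_p F p).
  apply: countable_bigcupT_measurable; first exact: countableP.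
  by move=> p; rewrite /F; case: ifP => // _; exact: mbox.
apply/seteqP; split => [t Ut|t [p _]]; last first.
  by rewrite /F; case: ifP => // /asboolP h ht; exact: h.
have : nbhs (phase_of_tuple t) U by exact: open_nbhs_nbhs.
move=> /nbhs_ballP[e /= e0 eU].
pose k := Num.truncn (2 / e).
have ke : 2 / k.+1%:R < e.
  rewrite ltr_pdivrMr// mulrC -ltr_pdivrMr//.
  by case/andP: (truncn_itv (divr_ge0 (ler0n R 2) (ltW e0))).
have /choice[q qt] : forall i : 'I_(N + N), exists r : rat,
    `|ratr r - tnth t i| < k.+1%:R^-1.
  move=> i.
  have : tnth t i - k.+1%:R^-1 < tnth t i + k.+1%:R^-1 :> R.
    by rewrite ltrD2l gtrN// invr_gt0.
  move=> /rat_in_itvoo[r]; rewrite in_itv /= => rP.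
  by exists r; rewrite ltr_distl.
exists (mktuple q, k) => //; rewrite /F ifT.
  by move=> i /=; rewrite tnth_mktuple.
apply/asboolP => s hs; apply: eU.
have st i : `|tnth t i - tnth s i| < e.
  apply: le_lt_trans ke.
  rewrite (_ : _ - _ = (ratr (q i) - tnth s i) - (ratr (q i) - tnth t i)); last first.
    by rewrite opprB [RHS]addrC addrA subrK.
  rewrite (le_trans (ler_normB _ _))// (_ : 2 = 1 + 1)// mulrDl mul1r lerD ?(ltW (qt i))//.
  by have := hs i; rewrite /= tnth_mktuple => /ltW.
by split; split=> // i j /=; rewrite !mxE; exact: st.
Qed.

Definition lebesgue_phase : set (borel Z) -> \bar R :=
  pushforward (lebesgue_tuple (N + N)) (phase_of_tuple : _ -> borel Z).

HB.instance Definition _ := Measure.copy lebesgue_phase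
  (measure_function_pushforward__canonical__measure_function_Measure
    (lebesgue_tuple (N + N)) measurable_phase_of_tuple).

Section thermalized.
Variable dot : {dot Z for idfun}.

Definition dot_norm (z : Z) : R := Num.sqrt (dot z z).

(* The real integral is `fine` of an extended one, which is finite for
   0 < beta, the only case used below. *)
Definition gauss_mass (beta : R) : R :=
  \int[lebesgue_phase]_xi expR (- beta * dot_norm xi ^+ 2).

Definition thermal_weight (beta : R) (p : Z * Z) : R :=
  (gauss_mass beta)^-1 * expR (- beta * dot_norm (p.1 - p.2) ^+ 2).

Definition thermalized (beta : R)
    (mu : {measure set (borel (Z * Z)%type) -> \bar R}) :
    set (borel (Z * Z)%type) -> \bar R :=
  fun A => (\int[mu]_(p in A) (thermal_weight beta p)%:E)%E.

Lemma dot_norm_continuous : continuous dot_norm.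
Proof.
pose e (i : 'I_N + 'I_N) : Z :=
  match i with inl i => ('e_i, 0) | inr i => (0, 'e_i) end.
pose x (i : 'I_N + 'I_N) (z : Z) : R :=
  match i with inl i => z.1 0 i | inr i => z.2 0 i end.
have zE z : z = \sum_i x i z *: e i.
  rewrite big_sumType /=; case: z => a b; apply: injective_projections => /=.
    rewrite !(big_morph fst (fun _ _ => erefl) erefl) /=.
    rewrite [X in _ + X]big1 ?addr0; last by move=> i _; rewrite scaler0.
    exact: row_sum_delta.
  rewrite !(big_morph snd (fun _ _ => erefl) erefl) /=.
  rewrite [X in X + _]big1 ?add0r; last by move=> i _; rewrite scaler0.
  exact: row_sum_delta.
have xc i : continuous (x i).
  case: i => i z; rewrite /x /continuous_at.
    apply: (@continuous_comp _ _ _ (fst : Z -> _) (fun M => M 0 i)).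
      exact: cvg_fst.
    exact: coord_continuous.
  apply: (@continuous_comp _ _ _ (snd : Z -> _) (fun M => M 0 i)).
    exact: cvg_snd.
  exact: coord_continuous.
have dotE : (fun z => dot z z) =
    fun z => \sum_i x i z * \sum_j x j z * dot (e i) (e j).
  apply/funext => z; rewrite {1}(zE z) linear_sumlz.
  apply: eq_bigr => i _; rewrite linearZl_LR /=; congr *%R.
  rewrite {1}(zE z) linear_sumr; apply: eq_bigr => j _.
  by rewrite linearZr_LR.
move=> z; apply: (@continuous_comp _ _ _ (fun z => dot z z) Num.sqrt).
  rewrite dotE; apply: cvg_big => [|i _]; first exact: add_continuous.
  apply: cvgM; first exact: xc.
  apply: cvg_big => [|j _]; first exact: add_continuous.
  by apply: cvgM; [exact: xc|exact: cvg_cst].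
exact: sqrt_continuous.
Qed.

Lemma thermal_weight_measurable beta :
  measurable_fun [set: borel (Z * Z)%type] (thermal_weight beta).
Proof.
apply: continuous_measurable_borel => p; rewrite /thermal_weight.
apply: cvgM; first exact: cvg_cst.
apply: continuous_comp; last exact: continuous_expR.
apply: cvgM; first exact: cvg_cst.
apply: (@continuous_comp _ _ _ (fun p : Z * Z => dot_norm (p.1 - p.2))
  (fun t : R => t ^+ 2)); last exact: exprn_continuous.
apply: (@continuous_comp _ _ _ (fun p : Z * Z => p.1 - p.2) dot_norm).
  by apply: cvgB; [exact: cvg_fst|exact: cvg_snd].
exact: dot_norm_continuous.
Qed.

Lemma thermal_weight_ge0 beta p : 0 <= thermal_weight beta p.
Proof.
by rewrite mulr_ge0 ?expR_ge0// invr_ge0 fine_ge0// integral_ge0.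
Qed.

Section thermalized_measure.
Variables (beta : R) (mu : {measure set (borel (Z * Z)%type) -> \bar R}).

Let thermalized0 : thermalized beta mu set0 = 0%E.
Proof. exact: integral_set0. Qed.

Let thermalized_ge0 A : (0 <= thermalized beta mu A)%E.
Proof.
by apply: integral_ge0 => p _; rewrite lee_fin thermal_weight_ge0.
Qed.

Let thermalized_sigma_additive : semi_sigma_additive (thermalized beta mu).
Proof.
move=> F mF tF mUF; rewrite /thermalized ge0_integral_bigcup//=.
- apply: is_cvg_ereal_nneg_natsum_cond => n _ _.
  by apply: integral_ge0 => p _; rewrite lee_fin thermal_weight_ge0.
- apply: measurable_funTS; apply/measurable_EFinP.
  exact: thermal_weight_measurable.
- by move=> p _; rewrite lee_fin thermal_weight_ge0.
Qed.

HB.instance Definition _ := isMeasure.Build _ _ _ (thermalized beta mu)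
  thermalized0 thermalized_ge0 thermalized_sigma_additive.

End thermalized_measure.

Definition diagonal_concentration
    (mu mu_oo : {measure set (borel (Z * Z)%type) -> \bar R}) : Prop :=
  [/\ exists2 beta0 : R, 0 <= beta0 &
        forall beta : R, beta0 < beta -> finite_radon (thermalized beta mu),
      finite_radon mu_oo &
      forall f : Z * Z -> R, bounded_continuous f ->
        (\int[thermalized beta mu]_p (f p)%:E)%E @[beta --> +oo] -->
        (\int[mu_oo]_p (f p)%:E)%E].

End thermalized.

End phase_space.

(* Main.v *)
(* Fix b > 0 and U a set of pairs with |y - z|^2 >= b. There, for a fixed beta1
   with nonzero mass, w_beta <= (B_beta1 / B_beta) e^(-(beta - beta1) b) w_beta1.
   Since 1/B_beta <= C e^(beta b/2), because B_beta is at least e^(-beta b/2)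
   times the volume of {|xi|^2 < b/2}, this gives
   mu_beta(U) <= C' e^(-beta b/2) mu_beta1(Z x Z), which tends to 0. Testing the
   convergence of mu_beta against min(max(|y - z|^2 - b, 0), 1) then shows that
   mu_oo vanishes on the open set {|y - z|^2 > b}. *)
Require Import Defs.
From HB Require Import structures.
From mathcomp Require Import all_boot all_order all_algebra.
From mathcomp Require Import sesquilinear.
From mathcomp Require Import all_classical all_reals all_analysis.
From mathcomp Require Import measurable_realfun ring.

Set Implicit Arguments.
Unset Strict Implicit.
Unset Printing Implicit Defensive.

Import Order.TTheory GRing.Theory Num.Theory.
Import numFieldNormedType.Exports.

Local Open Scope classical_set_scope.
Local Open Scope ring_scope.

Lemma open_borel_measurable (X : ptopologicalType) (U : set X) :
  open U -> measurable (U : set (borel X)).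
Proof. exact: sub_sigma_algebra. Qed.

(** * Positivity of Lebesgue measure near the origin *)

Section lebesgue_positive.
Context {R : realType}.
Local Notation RR := (measurableTypeR R).

Definition tuple_cube n (e : R) : set (n.-tuple RR) :=
  [set t | forall i, `|tnth t i : R| < e].

Arguments tuple_cube n e : clear implicits.

Lemma measurable_tuple_cube n (e : R) : measurable (tuple_cube n e).
Proof.
rewrite (_ : tuple_cube n e = \bigcap_(i in [set: 'I_n])
    ((fun t => tnth t i) @^-1` (ball (0 : R) e))); last first.
  apply/seteqP; split=> [t h i _|t h i].
    by rewrite /ball /= sub0r normrN; exact: h.
  by have := h i I; rewrite /ball /= sub0r normrN.
apply: fin_bigcap_measurable => // i _.
rewrite -[X in measurable X]setTI; apply: measurable_tnth => //.
exact: measurable_ball.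
Qed.

(** By induction on [n]: pulled back along [tcons], the cube is an interval of length 2e times a
    lower-dimensional cube. For [n = 0] the measure is a Dirac mass at the empty tuple, which lies
    in the cube vacuously. *)
Lemma lebesgue_tuple_cube_gt0 n (e : R) : 0 < e ->
  (0 < lebesgue_tuple n (tuple_cube n e))%E.
Proof.
move=> e0; elim: n => [|n IH].
  by rewrite /= diracE mem_set ?lte01// => -[].
rewrite [lebesgue_tuple _]/= /lebesgue_cons /pushforward.
rewrite (_ : _ @^-1` _ = ball (0 : R) e `*` tuple_cube n e); last first.
  apply/seteqP; split=> [[x t] h|[x t] [/= h1 h2] i].
    split=> [|i] /=.
      by have := h ord0; rewrite /ball /= sub0r normrN.
    by have := h (lift ord0 i); rewrite tnthS.
  case: (unliftP ord0 i) => [j ->|->]; first by rewrite tnthS; exact: h2.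
  by move: h1; rewrite /ball /= sub0r normrN.
rewrite product_measure1E//; last 2 first.
- exact: measurable_ball.
- exact: measurable_tuple_cube.
rewrite mule_gt0// [ltRHS](lebesgue_measure_ball _ (ltW e0)).
by rewrite lte_fin pmulrn_lgt0.
Qed.

(** Balls of the phase space are entrywise, so the preimage of a ball around 0 under
    [phase_of_tuple] contains the cube of the same radius. *)
Lemma lebesgue_phase_nbhs0_gt0 (N : nat) (U : set (phase_space R N)) :
  open U -> U 0 -> (0 < lebesgue_phase (U : set (borel (phase_space R N))))%E.
Proof.
move=> oU U0.
have /nbhs_ballP[e /= e0 eU] : nbhs (0 : phase_space R N) U.
  exact: open_nbhs_nbhs.
apply: lt_le_trans (lebesgue_tuple_cube_gt0 (N + N) e0) _.
rewrite /lebesgue_phase /pushforward; apply: le_measure.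
- by rewrite inE; exact: measurable_tuple_cube.
- rewrite inE -[X in measurable X]setTI; apply: measurable_phase_of_tuple => //.
  exact: open_borel_measurable.
- move=> t ht; apply: eU.
  by split; split=> // i j /=; rewrite !mxE /ball /= sub0r normrN; exact: ht.
Qed.

End lebesgue_positive.

(** * Decay of the thermalized measures off the diagonal *)

Section decay.
Context {R : realType} {N : nat}.
Local Notation Z := (phase_space R N).
Variable dot : {dot Z for idfun}.

Lemma dot_norm_sqr_continuous :
  continuous (fun p : Z * Z => dot_norm dot (p.1 - p.2) ^+ 2).
Proof.
move=> p.
apply: (@continuous_comp _ _ _ (fun p : Z * Z => dot_norm dot (p.1 - p.2))
  (fun t : R => t ^+ 2)); last exact: exprn_continuous.
apply: (@continuous_comp _ _ _ (fun p : Z * Z => p.1 - p.2) (dot_norm dot)).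
  by apply: cvgB; [exact: cvg_fst|exact: cvg_snd].
exact: dot_norm_continuous.
Qed.

Lemma dot_norm0 : dot_norm dot 0 = 0.
Proof. by rewrite /dot_norm linear0r sqrtr0. Qed.

Lemma dot_norm_gt0 z : z != 0 -> 0 < dot_norm dot z.
Proof. by move=> z0; rewrite sqrtr_gt0 neq0_dnorm_gt0. Qed.

(* The junk value [fine +oo = 0] of a divergent Gaussian integral satisfies
   the bound too, since [0^-1 = 0]. *)
Lemma gauss_mass_inv_le (r : R) : 0 < r ->
  exists2 C : R, 0 <= C &
    forall beta, 0 <= beta -> (gauss_mass dot beta)^-1 <= C * expR (beta * r).
Proof.
move=> r0; pose V : set Z := [set z | dot_norm dot z ^+ 2 < r].
have cn : continuous (fun z => dot_norm dot z ^+ 2).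
  move=> z; apply: (@continuous_comp _ _ _ (dot_norm dot) (fun t : R => t ^+ 2)).
    exact: dot_norm_continuous.
  exact: exprn_continuous.
have oV : open V.
  by move/continuousP: cn => /(_ [set x | x < r]); apply; exact: open_lt.
have V0 : (0 < lebesgue_phase (V : set (borel Z)))%E.
  apply: lebesgue_phase_nbhs0_gt0 => //.
  by rewrite /V /= dot_norm0 expr0n.
have mV := open_borel_measurable oV.
(* A real lower bound [m] suffices and avoids proving that [V] has finite volume. *)
have [m m0 mV_le] : exists2 m : R, 0 < m &
    (m%:E <= lebesgue_phase (V : set (borel Z)))%E.
  move: V0; case: (lebesgue_phase _) => [v|_|//].
    by rewrite lte_fin => v0; exists v.
  by exists 1 => //; rewrite leey.
exists m^-1; first by rewrite invr_ge0 ltW.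
move=> beta beta0.
have mG : measurable_fun [set: borel Z]
    (fun z : borel Z => (expR (- beta * dot_norm dot z ^+ 2))%:E).
  apply/measurable_EFinP; apply: continuous_measurable_borel => z.
  apply: continuous_comp; last exact: continuous_expR.
  by apply: cvgM; [exact: cvg_cst|exact: cn].
have : ((m * expR (- (beta * r)))%:E <=
    \int[lebesgue_phase]_xi (expR (- beta * dot_norm dot xi ^+ 2))%:E)%E.
  apply: (@le_trans _ _ (\int[@lebesgue_phase R N]_(xi in V)
      (expR (- beta * dot_norm dot xi ^+ 2))%:E)%E); last first.
    apply: ge0_subset_integral => //.
  apply: (@le_trans _ _ (\int[@lebesgue_phase R N]_(xi in V)
      cst (expR (- (beta * r)))%:E xi)%E).
    rewrite integral_cst// EFinM muleC.
    by apply: lee_wpmul2l => //; rewrite lee_fin expR_ge0.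
  apply: ge0_le_integral => //.
  - by move=> z _; rewrite lee_fin expR_ge0.
  - exact: measurable_funTS.
  - move=> z /ltW Vz; rewrite lee_fin ler_expR mulNr lerN2.
    exact: ler_wpM2l.
rewrite /gauss_mass /Rintegral.
have p0 : 0 < m * expR (- (beta * r)) by rewrite mulr_gt0 ?expR_gt0.
have -> : m^-1 * expR (beta * r) = (m * expR (- (beta * r)))^-1.
  by rewrite invfM -expRN opprK.
case: (integral _ _ _) => [v||//] /=.
- by rewrite lee_fin => h; rewrite lef_pV2 ?posrE// (lt_le_trans p0).
- by move=> _; rewrite invr0 invr_ge0 ltW.
Qed.

(** The Gaussian factor gains e^(-beta b), and half of that rate pays for the growth e^(beta b/2) of
    the inverse mass. A zero mass at [beta0] would make the reference weight vanish, since
    [0^-1 = 0]. *)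
Lemma thermal_weight_decay (b beta0 : R) :
  0 < b -> 0 <= beta0 -> gauss_mass dot beta0 != 0 ->
  exists2 C : R, 0 <= C & forall (beta : R) (p : Z * Z), beta0 <= beta ->
    b <= dot_norm dot (p.1 - p.2) ^+ 2 ->
    thermal_weight dot beta p <=
      C * expR (- (beta * (b / 2))) * thermal_weight dot beta0 p.
Proof.
move=> b0 beta0_ge0 B0.
have Bpos : 0 < gauss_mass dot beta0.
  by rewrite lt0r B0 fine_ge0// integral_ge0// => z _; rewrite lee_fin expR_ge0.
have [C C0 hC] := gauss_mass_inv_le (divr_gt0 b0 (ltr0n R 2)).
(* The mass cancels the normalization inside the weight at [beta0]; the exponential is what remains
   of e^(-(beta - beta0) b) once e^(-beta b) is split off. *)
exists (C * gauss_mass dot beta0 * expR (beta0 * b)).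
  by rewrite mulr_ge0 ?expR_ge0// mulr_ge0// ltW.
move=> beta p b0b bp; rewrite /thermal_weight.
set g := dot_norm dot _ ^+ 2 in bp *.
have h : expR (- beta * g) <= expR (- ((beta - beta0) * b)) * expR (- beta0 * g).
  rewrite -expRD ler_expR -subr_ge0.
  rewrite (_ : _ - _ = (beta - beta0) * (g - b)); last by ring.
  by rewrite mulr_ge0 ?subr_ge0.
apply: (le_trans (ler_pM _ (expR_ge0 _) (hC _ (le_trans beta0_ge0 b0b)) h)).
  by rewrite invr_ge0 fine_ge0// integral_ge0// => z _; rewrite lee_fin expR_ge0.
have e : expR (beta * (b / 2)) * expR (- ((beta - beta0) * b)) =
    expR (beta0 * b) * expR (- (beta * (b / 2))).
  by rewrite -!expRD; congr expR; field.
(* No slack remains: the two sides are equal. *)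
rewrite le_eqVlt; apply/orP; left; apply/eqP.
transitivity (C * (expR (beta * (b / 2)) * expR (- ((beta - beta0) * b))) *
  expR (- beta0 * g)); first by rewrite !mulrA.
by rewrite e; field.
Qed.

Lemma thermalized_off_diagonal (mu : {measure set (borel (Z * Z)%type) -> \bar R})
    (b beta0 : R) (U : set (Z * Z)) :
  0 < b -> 0 <= beta0 ->
  (forall beta, beta0 < beta -> (thermalized dot beta mu setT < +oo)%E) ->
  open U -> (forall p, U p -> b <= dot_norm dot (p.1 - p.2) ^+ 2) ->
  exists K : R, \forall beta \near +oo,
    (thermalized dot beta mu U <= (K * expR (- (beta * (b / 2))))%:E)%E.
Proof.
move=> b0 beta0_ge0 fin oU Ub; have mU := open_borel_measurable oU.
have mw beta (D : set (borel (Z * Z)%type)) :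
    measurable_fun D (fun p => (thermal_weight dot beta p)%:E).
  by apply: measurable_funTS; apply/measurable_EFinP;
    exact: thermal_weight_measurable.
have w0 beta p : (0 <= (thermal_weight dot beta p)%:E)%E.
  by rewrite lee_fin thermal_weight_ge0.
(* The reference [beta1] must exceed [beta0] strictly, so that its thermalized measure is finite. If
   all masses beyond [beta0] are 0, the weights there vanish identically and [K = 0] works. *)
have [[beta1 b01 B1]|noB] :=
  pselect (exists2 beta1, beta0 < beta1 & gauss_mass dot beta1 != 0); last first.
  exists 0; near=> beta; rewrite mul0r /thermalized integral0_eq// => p _.
  rewrite /thermal_weight; have [->|B] := eqVneq (gauss_mass dot beta) 0.
    by rewrite invr0 mul0r.
  by exfalso; apply: noB; exists beta => //; near: beta; by apply: nbhs_pinfty_gt; exact: num_real.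
have beta1_ge0 : 0 <= beta1 by exact: le_trans (ltW b01).
have [C C0 hC] := thermal_weight_decay b0 beta1_ge0 B1.
exists (C * fine (thermalized dot beta1 mu setT)).
near=> beta.
have b1b : beta1 <= beta by near: beta; by apply: nbhs_pinfty_ge; exact: num_real.
have Kge0 : 0 <= C * expR (- (beta * (b / 2))) by rewrite mulr_ge0 ?expR_ge0.
have T1 : thermalized dot beta1 mu setT \is a fin_num.
  by rewrite ge0_fin_numE ?fin//; exact: measure_ge0.
rewrite mulrAC EFinM fineK//.
rewrite /thermalized -ge0_integralZl_EFin//.
(* Compare the weights pointwise on [U], then enlarge [U] to the whole space. *)
apply: (@le_trans _ _ (\int[mu]_(p in U)
    ((C * expR (- (beta * (b / 2))))%:E * (thermal_weight dot beta1 p)%:E))%E).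
  apply: ge0_le_integral => //.
  - by apply: measurable_funeM; exact: mw.
  - by move=> p Up; rewrite -EFinM lee_fin; apply: hC => //; exact: Ub.
apply: ge0_subset_integral => //.
  by apply: measurable_funeM; exact: mw.
by move=> p _; rewrite mule_ge0.
Unshelve. all: by end_near. Qed.

End decay.

(** * Testing the convergence away from the diagonal *)

Theorem lemma4p3 (R : realType) (N : nat) (N_ge1 : (1 <= N)%N)
    (dot : {dot phase_space R N for idfun})
    (mu mu_oo : {measure set (borel (phase_space R N * phase_space R N)%type)
                   -> \bar R})
    (mu_radon : radon mu)
    (mu_diag : diagonal_concentration dot mu mu_oo) :
  supp mu_oo `<=` diagonal.
Proof.
move=> x sx; rewrite /diagonal/=; apply: contrapT => xne.
have [[beta0 beta0_ge0 fin] _ lim] := mu_diag.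
pose g (p : phase_space R N * phase_space R N) := dot_norm dot (p.1 - p.2) ^+ 2.
have gc : continuous g := @dot_norm_sqr_continuous R N dot.
have gx : 0 < g x.
  by rewrite exprn_gt0// dot_norm_gt0// subr_eq0; exact/eqP.
(* Halving puts [x] strictly inside [U] while keeping [U] at a positive distance from the
   diagonal. *)
pose b := g x / 2.
have b0 : 0 < b by rewrite divr_gt0.
pose U := [set p | b < g p].
have oU : open U.
  by move/continuousP: gc => /(_ [set y | b < y]); apply; exact: open_gt.
have mU := open_borel_measurable oU.
(* The two truncations give [f <= \1_U], so the integral of [f] against the thermalized measure is
   at most the mass of [U]; [f] stays positive on all of [U]. *)
pose f p := Num.min (Num.max (g p - b) 0) 1.
have f_ge0 p : 0 <= f p by rewrite /f le_min ler01 le_max lexx orbT.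
have f_le1 p : f p <= 1 by rewrite /f ge_min lexx orbT.
have fU p : ~ U p -> f p = 0.
  move=> /negP; rewrite -leNgt => pb.
  by rewrite /f max_r ?subr_le0// min_l.
have f_gt0 p : U p -> 0 < f p.
  by move=> Up; rewrite /f lt_min ltr01 lt_max subr_gt0 [b < g p]Up.
have fc : continuous f.
  move=> p; apply: (@continuous_min _ _ (fun p => Num.max (g p - b) 0) (cst 1)).
    apply: (@continuous_max _ _ (fun p => g p - b) (cst 0)); last exact: cvg_cst.
    by apply: cvgB; [exact: gc|exact: cvg_cst].
  exact: cvg_cst.
have mf : measurable_fun [set: borel (phase_space R N * phase_space R N)%type]
    (EFin \o f).
  by apply/measurable_EFinP; exact: continuous_measurable_borel.
have bcf : bounded_continuous f.
  by split => //; exists 1 => p; rewrite ger0_norm.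
have finT beta : beta0 < beta -> (thermalized dot beta mu setT < +oo)%E.
  by move=> /fin[].
have [K hK] := thermalized_off_diagonal b0 beta0_ge0 finT oU
  (fun p (Up : U p) => ltW Up).
(* The integrals against the thermalized measures are squeezed to 0, and by hypothesis they also
   tend to this one; limits are unique. *)
have int0 : (\int[mu_oo]_p (f p)%:E = 0)%E.
  have f0 : (\int[thermalized dot beta mu]_p (f p)%:E)%E @[beta --> +oo] --> 0%E.
    apply: (@squeeze_cvge _ _ _ _ (cst 0%E) _
      (fun beta => (K * expR (- (beta * (b / 2))))%:E)).
    - near=> beta; apply/andP; split.
        by apply: integral_ge0 => p _; rewrite lee_fin.
      apply: (@le_trans _ _ (thermalized dot beta mu U)); last first.
        by near: beta; exact: hK.
      have -> : thermalized dot beta mu U =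
          (\int[thermalized dot beta mu]_p (\1_U p)%:E)%E.
        by rewrite integral_indic// setIT.
      apply: ge0_le_integral => //.
      + by move=> p _; rewrite lee_fin.
      + by apply/measurable_EFinP; exact: measurable_indic.
      + move=> p _; rewrite lee_fin indicE.
        have [/set_mem Up|/negP Up] := boolP (p \in U); first exact: f_le1.
        by rewrite fU// => /mem_set.
    - exact: cvg_cst.
    - apply: cvg_EFin; first by near=> beta.
      rewrite -[X in _ --> X](mulr0 K); apply: cvgM; first exact: cvg_cst.
      apply: (cvg_comp (fun beta : R => beta * (b / 2)) (fun y => expR (- y))).
        by apply: gt0_cvgMly => //; rewrite divr_gt0.
      exact: cvgr_expR.
  exact: (cvg_unique _ (lim f bcf) f0).
(* A nonnegative function with zero integral vanishes almost everywhere; as [f] is positive on [U],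
   the set [U] lies in a null set. *)
have ae0 : ae_eq mu_oo setT (EFin \o f) (cst 0%E).
  apply/(ae_eq_integral_abs mu_oo measurableT mf).
  by under eq_integral => p _ do rewrite /= ger0_norm//.
have [A [mA A0 hA]] := ae0.
have U0 : mu_oo U = 0%E.
  apply: (subset_measure0 mU mA) A0 => p Up; apply: hA => /= /(_ I)[] fp.
  by have := f_gt0 p Up; rewrite fp ltxx.
have /sx : open_nbhs x U.
  by split => //; rewrite /U/= /b ltr_pdivrMr// ltr_pMr// ltr1n.
by rewrite U0 ltxx.
Unshelve. all: by end_near. Qed.
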